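(* Let $G$ be a graph such that for every $n\in\mathbb{N}$ there is a finite path of length at least $n$ which is an isometric induced subgraph of $G$. Then there are pairwise disjoint finite sets $V_0,V_1,\dots$ of vertices of $G$ such that each $G_{\restriction V_k}$ is a path which is an isometric subgraph of $G$, the lengths of these paths are unbounded, and the subgraph of $G$ induced on $\bigcup_k V_k$ is the direct sum of the $G_{\restriction V_k}$ (i.e. there are no edges between distinct $V_k$).
   Context: Graphs are undirected, simple, loopless. For vertices $x,y$ of $G$, $d_G(x,y)$ is the length of a shortest path joining them ($+\infty$ if none). An induced subgraph $G'$ of $G$ on a set $A$ is isometric if $d_{G'}(x,y)=d_G(x,y)$ for all $x,y\in A$. A path is a graph whose vertices can be injectively mapped into an interval of $\mathbb{Z}$ so that two vertices are adjacent iff their images differ by $1$; its length is the number of vertices minus one. $G_{\restriction A}$ denotes the subgraph induced on $A$. *)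

(* Defs.v *)
From HB Require Import structures.
From mathcomp Require Import all_boot all_order all_algebra.
From mathcomp Require Import all_classical.
From mathcomp Require Import num_normedtype.

Set Implicit Arguments.
Unset Strict Implicit.
Unset Printing Implicit Defensive.

Import Order.TTheory GRing.Theory Num.Theory.
Local Open Scope classical_set_scope.

(* The vertex set is an arbitrary, possibly infinite, type. *)
Record sgraph := SGraph {
  vertex :> Type;
  adj : vertex -> vertex -> Prop;
  adj_sym : forall x y, adj x y -> adj y x;
  adj_irrefl : forall x, ~ adj x x }.

Lemma induced_sym (G : sgraph) (A : set G) (x y : set_type A) :
  adj (sval x) (sval y) -> adj (sval y) (sval x).
Proof. exact: adj_sym. Qed.

Lemma induced_irrefl (G : sgraph) (A : set G) (x : set_type A) :
  ~ adj (sval x) (sval x).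
Proof. exact: adj_irrefl. Qed.

Definition induced (G : sgraph) (A : set G) : sgraph :=
  @SGraph (set_type A) (fun x y => adj (sval x) (sval y))
    (@induced_sym G A) (@induced_irrefl G A).

(* The path runs through the n + 1 distinct vertices p 0, ..., p n. *)
Definition path_joining (G : sgraph) (x y : G) (n : nat) : Prop :=
  exists p : 'I_n.+1 -> G,
    [/\ injective p, p ord0 = x, p ord_max = y &
        forall i j : 'I_n.+1, j = i.+1 :> nat -> adj (p i) (p j)].

(* None stands for +oo. *)
Definition dist (G : sgraph) (x y : G) : option nat :=
  if pselect (exists n, `[< path_joining x y n >]) is left ex
  then Some (ex_minn ex) else None.

Definition isometric (G : sgraph) (A : set G) : Prop :=
  forall x y : induced A, @dist (induced A) x y = @dist G (sval x) (sval y).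

(* The image of the injection is the whole interval (otherwise, say, every
   finite edgeless graph would qualify), and it is nonempty, so that the
   length of a finite path is a natural number. *)
Definition is_path (G : sgraph) : Prop :=
  exists f : G -> int,
    [/\ injective f, is_interval (range f), range f !=set0 &
        forall x y : G, adj x y <-> (`|f x - f y| = 1 :> int)%R].

Definition has_length (G : sgraph) (n : nat) : Prop :=
  ([set: G] #= `I_n.+1)%card.

(* Main.v *)
Require Import Defs.
From HB Require Import structures.
From mathcomp Require Import all_boot all_order all_algebra.
From mathcomp Require Import all_classical.
From mathcomp Require Import zify.
Set Implicit Arguments.
Unset Strict Implicit.
Unset Printing Implicit Defensive.

Import Order.TTheory GRing.Theory Num.Theory.

(* A closed neighbourhood of a vertex has diameter at most 2, so it meets an
   isometric path in vertices whose indices differ by at most 2.  Hence, of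
   the two segments [0, m] and [m + 3, 2m + 3] of an isometric path
   of length 2m + 3, at least one stays off the closed neighbourhood of any
   given vertex.  Iterating, there are arbitrarily long isometric paths that
   stay off the closed neighbourhood of any given finite set, and the V_k are
   chosen greedily, each off the closed neighbourhood of its predecessors. *)

Local Open Scope classical_set_scope.

(** * Joining paths and distance *)

Lemma distP (G : sgraph) (x y : G) (n : nat) :
  dist x y = Some n <->
  path_joining x y n /\ forall m, path_joining x y m -> (n <= m)%N.
Proof.
rewrite /dist; case: pselect => [ex|nex]; last first.
  by split=> // -[xyn _]; case: nex; exists n; apply/asboolP.
case: ex_minnP => d /asboolP xyd dmin; split=> [[<-]|[xyn nmin]].
  by split=> // m xym; apply/dmin/asboolP.
by congr Some; apply/eqP; rewrite eqn_leq nmin // dmin //; apply/asboolP.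
Qed.

Lemma path_joining_dist (G : sgraph) (x y : G) (m : nat) :
  path_joining x y m -> exists2 d, dist x y = Some d & (d <= m)%N.
Proof.
move=> xym; case E: (dist x y) => [d|].
  by exists d => //; move/distP: E => [_]; apply.
by move: E; rewrite /dist; case: pselect => // -[]; exists m; apply/asboolP.
Qed.

Lemma path_joining_sym (G : sgraph) (x y : G) (n : nat) :
  path_joining x y n -> path_joining y x n.
Proof.
move=> [p [pinj p0 pn padj]]; exists (p \o @rev_ord _); split=> /=.
- exact: inj_comp pinj rev_ord_inj.
- by rewrite -pn; congr p; apply: val_inj; rewrite /= subn1.
- by rewrite -p0; congr p; apply: val_inj; rewrite /= subnn.
- move=> i j ij; apply: adj_sym; apply: padj => /=.
  by have := ltn_ord j; rewrite ij; lia.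
Qed.

Lemma path_joining_refl (G : sgraph) (x : G) : path_joining x x 0.
Proof.
exists (fun=> x); split=> // [i j _|i j].
  by rewrite (ord1 i) (ord1 j).
by rewrite (ord1 i) (ord1 j).
Qed.

Lemma path_joining_nat (G : sgraph) (p : nat -> G) (n : nat) :
    (forall i j, (i <= n)%N -> (j <= n)%N -> p i = p j -> i = j) ->
    (forall i, (i < n)%N -> adj (p i) (p i.+1)) ->
  path_joining (p 0%N) (p n) n.
Proof.
move=> pinj padj; exists (fun i => p i); split=> // [i j pij|i j ij].
  by apply: val_inj; apply: pinj; rewrite ?leq_ord.
by rewrite ij; apply: padj; have := ltn_ord j; rewrite ij ltnS.
Qed.

Lemma path_joining_adj (G : sgraph) (x y : G) : adj x y -> path_joining x y 1.
Proof.
(* The sequence x, y, y, ...: the default of [nth] supplies the endpoint. *)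
move=> xy; apply: (@path_joining_nat G (nth y [:: x])).
  have nxy : x <> y by move=> e; move: xy; rewrite e; exact: adj_irrefl.
  by move=> [|[|i]] [|[|j]] // _ _ /= e; case: nxy.
by case.
Qed.

Lemma path_joining_adj2 (G : sgraph) (x v y : G) :
  x <> y -> adj x v -> adj v y -> path_joining x y 2.
Proof.
move=> nxy xv vy; apply: (@path_joining_nat G (nth y [:: x; v])).
  have nxv : x <> v by move=> e; move: xv; rewrite e; exact: adj_irrefl.
  have nvy : v <> y by move=> e; move: vy; rewrite e; exact: adj_irrefl.
  by move=> [|[|[|i]]] [|[|[|j]]] // _ _ /= e; exfalso;
    (apply: nxv + apply: nvy + apply: nxy).
by move=> [|[]].
Qed.

Lemma path_joining_induced (G : sgraph) (A : set G) (x y : induced A) n :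
  path_joining x y n -> path_joining (sval x) (sval y) n.
Proof.
move=> [p [pinj p0 pn padj]]; exists (fun i => sval (p i)); split=> //.
- by move=> i j pij; apply/pinj/val_inj.
- by rewrite p0.
- by rewrite pn.
Qed.

(** Each edge changes [f] by exactly 1, so the triangle inequality applies. This bounds distances
    inside an induced path from below. *)
Lemma path_joining_interval (G : sgraph) (f : G -> int) (x y : G) n :
    (forall u v : G, adj u v -> (`|f u - f v| = 1 :> int)%R) ->
  path_joining x y n -> (`|f x - f y| <= n%:Z)%R.
Proof.
move=> fadj [p [_ <- <- padj]].
suff H k (kn : (k < n.+1)%N) : (`|f (p ord0) - f (p (Ordinal kn))| <= k%:Z)%R.
  by rewrite (_ : ord_max = Ordinal (ltnSn n)) //; apply: val_inj.
elim: k kn => [|k IH] kn.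
  by rewrite (_ : Ordinal kn = ord0) ?subrr //; apply: val_inj.
have /fadj := padj (Ordinal (ltnW kn)) (Ordinal kn) erefl.
have := IH (ltnW kn).
by move: (f _) (f _) (f _) => a b c; lia.
Qed.

(** * Geodesics *)

(** Isometric paths as sequences on [nat], so that passing to a segment is a shift of the index; [p]
    is unconstrained beyond [n]. *)
Definition geodesic (G : sgraph) (p : nat -> G) (n : nat) : Prop :=
  (forall i, (i < n)%N -> adj (p i) (p i.+1)) /\
  (forall i j m, (i <= j <= n)%N -> path_joining (p i) (p j) m ->
     (j - i <= m)%N).

Lemma geodesic_shift (G : sgraph) (p : nat -> G) n a m :
  geodesic p n -> (a + m <= n)%N -> geodesic (fun i => p (a + i)%N) m.
Proof.
move=> [padj pmin] amn; split=> [i im|i j k ijm /pmin].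
  by rewrite addnS; apply: padj; lia.
by rewrite subnDl; apply; lia.
Qed.

(** Equal vertices are joined by a path of length 0, so minimality leaves no gap between their
    indices. *)
Lemma geodesic_inj (G : sgraph) (p : nat -> G) n i j :
  geodesic p n -> (i <= n)%N -> (j <= n)%N -> p i = p j -> i = j.
Proof.
move=> [_ pmin]; wlog ij : i j / (i <= j)%N => [hw|] iln jn pij.
  by case/orP: (leq_total i j) => ij; [|symmetry]; apply: hw.
have /pmin : path_joining (p i) (p j) 0 by rewrite pij; exact: path_joining_refl.
by rewrite ij jn => /(_ isT); lia.
Qed.

Lemma geodesic_path_joining (G : sgraph) (p : nat -> G) n i j :
  geodesic p n -> (i <= j <= n)%N -> path_joining (p i) (p j) (j - i)%N.
Proof.
move=> gp ijn; have [|g1 _] := geodesic_shift (a := i) (m := (j - i)%N) gp; first by lia.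
have := @path_joining_nat G (fun k => p (i + k)%N) (j - i)%N.
rewrite addn0 subnKC; last by lia.
apply=> // k l kn ln /(geodesic_inj gp); lia.
Qed.

Lemma geodesic_near (G : sgraph) (p : nat -> G) n (v : G) i j :
    geodesic p n -> (i <= j <= n)%N ->
    p i = v \/ adj v (p i) -> p j = v \/ adj v (p j) ->
  (j <= i + 2)%N.
Proof.
move=> gp ijn vi vj; have [_ pmin] := gp.
have near m : path_joining (p i) (p j) m -> (m <= 2)%N -> (j <= i + 2)%N.
  by move=> /(pmin _ _ _ ijn); lia.
(* Coinciding vertices are treated apart: going to [v] and back is not injective, hence not a
   joining path. *)
have [e|ne] := pselect (p i = p j).
  by have := geodesic_inj gp _ _ e; lia.
case: vi vj => [vi|vi] [vj|vj].
- by case: ne; rewrite vi vj.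
- by apply: (near 1%N) => //; rewrite vi; apply: path_joining_adj.
- by apply: (near 1%N) => //; rewrite vj; apply/path_joining_adj/adj_sym.
- by apply: (near 2%N) => //; apply: path_joining_adj2 ne (adj_sym vi) vj.
Qed.

(** * Avoiding closed neighbourhoods *)

(** The first clause will make the V_k disjoint, the second will exclude edges between them. *)
Definition avoids (G : sgraph) (F : set G) (p : nat -> G) (n : nat) : Prop :=
  forall v i, F v -> (i <= n)%N -> p i <> v /\ ~ adj v (p i).

Lemma geodesic_avoid1 (G : sgraph) (p : nat -> G) m (v : G) :
  geodesic p (2 * m + 3) ->
  exists a, (a <= m + 3)%N /\ avoids [set v] (fun i => p (a + i)%N) m.
Proof.
move=> gp.
have [[i [im vi]]|nv] :=
    pselect (exists i, (i <= m)%N /\ (p i = v \/ adj v (p i))).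
  exists (m + 3)%N; split=> // w j -> jm.
  have far : ~ (p (m + 3 + j)%N = v \/ adj v (p (m + 3 + j)%N)).
    by move=> vj; have := geodesic_near gp _ vi vj; lia.
  by split=> vj; apply: far; [left|right].
exists 0%N; split=> // w j -> jm.
by split=> vj; apply: nv; exists j; split=> //; [left|right].
Qed.

(** Induction on [N] for all [n] at once: a geodesic of length 2n + 3 off the first [N] terms has a
    segment of length [n] that is also off [u N]. *)
Lemma geodesic_avoid_seq (G : sgraph) (u : nat -> G) N n :
    (forall m, exists p : nat -> G, geodesic p m) ->
  exists p : nat -> G, geodesic p n /\ avoids (u @` `I_N) p n.
Proof.
move=> Hgeo; elim: N n => [|N IH] n.
  by have [p gp] := Hgeo n; exists p; split=> // v i [k]; rewrite /= ltn0.
have [p [gp pav]] := IH (2 * n + 3)%N.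
have [a [am pav1]] := geodesic_avoid1 (u N) gp.
exists (fun i => p (a + i)%N); split; first by apply: geodesic_shift gp _; lia.
move=> v i [k /= kN <-] iln; move: kN; rewrite ltnS leq_eqVlt => /orP[/eqP ->|kN].
  exact: pav1.
by apply: pav; [exists k | lia].
Qed.

Lemma geodesic_avoid_finite (G : sgraph) (F : set G) n :
    (forall m, exists p : nat -> G, geodesic p m) -> finite_set F ->
  exists p : nat -> G, geodesic p n /\ avoids F p n.
Proof.
(* Either [F] is empty or the first [N] terms of a sequence [u] cover it. *)
move=> Hgeo /finite_setP[N]; rewrite card_eq_le => /andP[/pfcard_geP[->|[u]] _].
  by have [p gp] := Hgeo n; exists p.
have [p [gp pav]] := geodesic_avoid_seq u N n Hgeo; exists p; split=> // v i Fv.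
have [k kN <-] := @surj _ _ _ _ u v Fv.
by apply: pav; exists k.
Qed.

(** * From isometric induced paths to geodesics *)

Lemma path_geodesic (G : sgraph) (A : set G) l :
    is_path (induced A) -> isometric A -> has_length (induced A) l ->
  exists p : nat -> G, geodesic p l.
Proof.
move=> [f [finj fint _ fadj]] Aiso.
rewrite /has_length card_eq_sym card_eq_le => /andP[/card_leP[g] _].
have gI (i : 'I_l.+1) : (i : nat) \in `I_l.+1 by rewrite inE /=.
pose h (i : 'I_l.+1) : induced A := val (g (SigSub (gI i))).
have hinj : injective h.
  by move=> i j /val_inj /inj; rewrite !inE => /(_ I I) [] /val_inj.
pose i0 := [arg min_(i < ord0 : 'I_l.+1) f (h i)]%O.
have fi0 i : (f (h i0) <= f (h i))%R.
  by rewrite /i0; case: arg_minP => // k _; apply.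
(* Pigeonhole: otherwise [f] would map l + 1 distinct vertices injectively into [l] consecutive
   integers. *)
have [y fy] : exists y, (f (h i0) + l%:Z <= f y)%R.
  apply: contrapT => ny.
  have lt i : (`|f (h i) - f (h i0)| < l)%N.
    have [fl|] := lerP (f (h i0) + l%:Z)%R (f (h i)).
      by case: ny; exists (h i).
    by have := fi0 i; lia.
  suff /leq_card : injective (fun i => Ordinal (lt i)) by rewrite !card_ord ltnn.
  by move=> i j [] e; apply/hinj/finj; have := fi0 i; have := fi0 j; lia.
(* The range of [f] is an interval, so no value is skipped; for k > l, [y] is a dummy that makes the
   choice total. *)
have fq k : exists x : induced A, (k <= l)%N -> f x = (f (h i0) + k%:Z)%R.
  have [kl|] := boolP (k <= l)%N; last by exists y.
  have [|||x _ fx] := fint (f (h i0)) (f y) _ _ (f (h i0) + k%:Z)%R.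
  - by exists (h i0).
  - by exists y.
  - by lia.
  - by exists x.
have [q qf] := choice fq.
exists (fun k => sval (q k)); split=> [i il|i j m ijl].
  have /fadj : (`|f (q i) - f (q i.+1)| = 1 :> int)%R.
    by rewrite !qf ?(ltnW il) //; lia.
  by [].
(* By isometry the distance in [G] is realised by a path inside [A], where [f] bounds its length
   below by j - i. *)
move=> /path_joining_dist[d]; rewrite -Aiso => /distP[+ _] dm.
move=> /(path_joining_interval (fun u v => proj1 (fadj u v))).
by rewrite !qf; lia.
Qed.

(** * From geodesics back to isometric induced paths *)

Section GeodesicRange.
Variables (G : sgraph) (p : nat -> G) (n : nat).
Hypothesis gp : geodesic p n.
Let V : set G := p @` `I_n.+1.

Lemma geodesic_range_length : has_length (induced V) n.
Proof.
rewrite /has_length; apply: (card_eq_trans (card_setT V)).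
apply: inj_card_eq => i j; rewrite !inE /= !ltnS; exact: geodesic_inj gp.
Qed.

Lemma geodesic_index (x : induced V) : exists i, (i <= n)%N /\ sval x = p i.
Proof. by case: x => x /= /[dup] /set_mem [i /= iln <-] _; exists i. Qed.

Lemma geodesic_range_path : is_path (induced V).
Proof.
have [f fP] := choice geodesic_index.
have Vp i : (i <= n)%N -> p i \in V by move=> iln; rewrite inE; exists i.
have fp i (iln : (i <= n)%N) : f (SigSub (Vp i iln)) = i.
  have [fn e] := fP (SigSub (Vp i iln)).
  by apply: (geodesic_inj gp) => //; rewrite -e.
exists (fun x => Posz (f x)); split.
- move=> x y [fxy]; apply: val_inj.
  by have [_ /= ->] := fP x; have [_ /= ->] := fP y; rewrite fxy.
- move=> _ _ [x _ <-] [y _ <-] z xzy.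
  have zn : (`|z|%N <= n)%N by have [+ _] := fP y; lia.
  by exists (SigSub (Vp _ zn)) => //; rewrite fp; lia.
- by exists (f (SigSub (Vp 0%N isT))); exists (SigSub (Vp 0%N isT)).
- move=> x y; have [fx ex] := fP x; have [fy ey] := fP y.
  rewrite /adj /= ex ey; have [padj pmin] := gp; split=> [xy|xy].
    (* An edge is a joining path of length 1, so minimality in both directions leaves indices
       differing by at most 1; looplessness excludes 0. *)
    have ne : f x <> f y.
      by move=> e; move: xy; rewrite e; apply: adj_irrefl.
    have := pmin (f x) (f y) _ _ (path_joining_adj xy).
    have := pmin (f y) (f x) _ _ (path_joining_adj (adj_sym xy)).
    by lia.
  have [e|e] : f y = (f x).+1 \/ f x = (f y).+1 by lia.
    by rewrite e; apply: padj; rewrite -e.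
  by apply: adj_sym; rewrite e; apply: padj; rewrite -e.
Qed.

Lemma geodesic_range_isometric : isometric V.
Proof.
move=> x y.
have [i [iln xi]] := geodesic_index x; have [j [jn yj]] := geodesic_index y.
(* Paths in [V] are paths in [G], so a length attained inside [V] and minimal in [G] is the distance
   in both. *)
suff [d [xyd dmin]] : exists d, @path_joining (induced V) x y d /\
    forall m, path_joining (sval x) (sval y) m -> (d <= m)%N.
  transitivity (Some d); [|symmetry]; apply/distP; split=> //.
    by move=> m /path_joining_induced; apply: dmin.
  exact: path_joining_induced.
wlog ij : x y i j iln xi jn yj / (i <= j)%N => [hw|].
  case/orP: (leq_total i j) => ij; first exact: hw ij.
  have [d [yxd dmin]] := hw y x _ _ jn yj iln xi ij.
  exists d; split; first exact: path_joining_sym.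
  by move=> m /path_joining_sym; apply: dmin.
exists (j - i)%N; split; last first.
  by rewrite xi yj => m; have [_] := gp; apply; rewrite ij.
have Vp k : exists z : induced V, (k <= n)%N -> sval z = p k.
  have [kn|] := boolP (k <= n)%N; last by exists x.
  have Vk : p k \in V by rewrite inE; exists k.
  by exists (SigSub Vk).
have [q qp] := choice Vp.
have -> : x = q (i + 0)%N by apply: val_inj; rewrite /= addn0 qp.
have -> : y = q (i + (j - i))%N by apply: val_inj; rewrite /= subnKC // qp.
apply: (@path_joining_nat _ (fun k => q (i + k)%N)) => [k m kl ml|k kl].
  move=> /(congr1 sval); rewrite !qp; try lia.
  by move=> /(geodesic_inj gp); lia.
by rewrite /adj /= !qp; try lia; rewrite addnS; apply: (proj1 gp); lia.
Qed.

End GeodesicRange.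

Theorem theorem3 (G : sgraph)
  (HG : forall n : nat, exists (A : set G) (l : nat),
      [/\ finite_set A, is_path (induced A), isometric A,
          has_length (induced A) l & (n <= l)%N]) :
  exists V : nat -> set G,
    [/\ trivIset [set: nat] V,
        forall k : nat, finite_set (V k),
        forall k : nat, is_path (induced (V k)) /\ isometric (V k),
        forall n : nat, exists k l : nat,
          has_length (induced (V k)) l /\ (n <= l)%N &
        forall j k : nat, j <> k ->
          forall x y : G, V j x -> V k y -> ~ adj x y].
Proof.
have Hgeo m : exists p : nat -> G, geodesic p m.
  have [A [l [_ Apath Aiso Al ml]]] := HG m.
  have [p gp] := path_geodesic Apath Aiso Al.
  by exists p; apply: (geodesic_shift (a := 0%N) gp).
(* Finiteness is a premise under the existential, so that a selector defined on all sets can be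
   chosen before the recursion. *)
have Hsel (Fn : set G * nat) : exists p : nat -> G,
    finite_set Fn.1 -> geodesic p Fn.2 /\ avoids Fn.1 p Fn.2.
  have [fF|] := pselect (finite_set Fn.1).
    by have [p] := geodesic_avoid_finite Fn.2 Hgeo fF; exists p.
  by have [p _] := Hgeo 0%N; exists p.
have [sel selP] := choice Hsel.
pose range_of F n : set G := sel (F, n) @` `I_n.+1.
(* [F k] is the union of the V_j with j < k; the path chosen at stage [k] has length [k], whence
   unbounded lengths. *)
pose fix F k : set G := if k is m.+1 then F m `|` range_of (F m) m else set0.
pose V k := range_of (F k) k.
have Vfin_of A n : finite_set (range_of A n).
  exact: finite_image (finite_II _).
have Ffin k : finite_set (F k).
  by elim: k => [|k IH] /=; [exact: finite_set0 | rewrite finite_setU].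
have gV k : geodesic (sel (F k, k)) k by have [] := selP (F k, k) (Ffin k).
have VF j k : (j < k)%N -> V j `<=` F k.
  elim: k => // k IH; rewrite ltnS leq_eqVlt => /orP[/eqP ->|/IH jk] x Vx.
    by right.
  by left; apply: jk.
(* The later path avoids the earlier ones; both conclusions are symmetric, which covers j > k. *)
have VV j k x y : (j < k)%N -> V j x -> V k y -> y <> x /\ ~ adj x y.
  move=> jk Vx [i /= ik <-]; have [_] := selP (F k, k) (Ffin k).
  by apply; [exact: VF jk _ Vx |].
exists V; split.
- move=> j k _ _ [x [Vj Vk]].
  by case: (ltngtP j k) => // jk; [have [] := VV _ _ _ _ jk Vj Vk
                                  |have [] := VV _ _ _ _ jk Vk Vj].
- by move=> k; exact: Vfin_of.
- move=> k; split; first exact: geodesic_range_path.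
  exact: geodesic_range_isometric.
- by move=> n; exists n, n; split=> //; exact: geodesic_range_length.
- move=> j k /eqP; rewrite neq_ltn => /orP[] jk x y Vx Vy.
    by have [] := VV _ _ _ _ jk Vx Vy.
  by move=> /adj_sym; have [] := VV _ _ _ _ jk Vy Vx.
Qed.
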